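(* Suppose that $1<d\le n-2$ and $n$ is sufficiently large. (1) When $d=\delta n$ with $\delta\in(0.1313,1)$, $A(n,d)\le 1.2\,(C_\delta n)^{n-d}$, where $C_\delta=\frac{e}{2}\,\delta^{\frac{\delta}{1-\delta}}\in(1/2,1)$. Moreover $C_\delta$ is decreasing in $\delta$ and $C_\delta\to\frac12$ as $\delta\to1$. (2) When $d=n-\theta$ with $2\le\theta=o(n)$, we have: (i) $A(n,d)\le\left(\left(\tfrac12+o(1)\right)n\right)^{n-d-1}$ if $\theta=\Omega(\sqrt n)$ and $\theta=o(n)$; (ii) $A(n,d)\le 2.1\left(\tfrac n2\right)^{n-d-1}$ if $\theta=o(\sqrt n)$; (iii) $A(n,d)\le 2\left(\tfrac n2\right)^{n-d-1}+O(n^{n-d-2})$ if $\theta$ is a constant.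
   Context: $[n]=\{1,\dots,n\}$, and $\mathcal{T}(n)$ is the set of all spanning trees of the complete graph on vertex set $[n]$. The tree-distance of $T_1=([n],E_1)$ and $T_2=([n],E_2)$ in $\mathcal{T}(n)$ is $d(T_1,T_2)=n-1-|E_1\cap E_2|$. $A(n,d)$ is the maximum size of a set $\mathcal{C}\subseteq\mathcal{T}(n)$ whose distinct elements have pairwise tree-distance at least $d$. In (1), $\delta$ is a constant; in (2), $\theta=\theta(n)$ is an integer that may depend on $n$. All asymptotics are as $n\to\infty$. *)

(* Defs.v *)
From HB Require Import structures.
From mathcomp Require Import all_boot all_order all_algebra.
From mathcomp Require Import all_classical all_reals all_analysis.

Set Implicit Arguments.
Unset Strict Implicit.
Unset Printing Implicit Defensive.

Import Order.TTheory GRing.Theory Num.Theory.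
Import numFieldNormedType.Exports.

Local Open Scope classical_set_scope.
Local Open Scope ring_scope.

(* A graph on the vertex set 'I_n is given by its set of edges, an edge being
   a set of two vertices. *)
Definition complete_edges (n : nat) : {set {set 'I_n}} :=
  [set e : {set 'I_n} | #|e| == 2]%SET.

Definition adj (n : nat) (E : {set {set 'I_n}}) : rel 'I_n :=
  fun x y => [set x; y]%SET \in E.

Definition connected_graph (n : nat) (E : {set {set 'I_n}}) : Prop :=
  forall x y : 'I_n, connect (adj E) x y.

(* The bound on the size matters: on a symmetric relation, ucycle accepts
   [:: x; y] for every edge xy. *)
Definition acyclic_graph (n : nat) (E : {set {set 'I_n}}) : Prop :=
  forall c : seq 'I_n, (2 < size c)%N -> ~ ucycle (adj E) c.

Definition spanning_trees (n : nat) : {set {set {set 'I_n}}} :=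
  [set E : {set {set 'I_n}} | (E \subset complete_edges n) &&
     `[< connected_graph E /\ acyclic_graph E >]]%SET.

(* On spanning trees the truncated subtraction is exact, since such a graph
   has n - 1 edges. *)
Definition tree_dist (n : nat) (E1 E2 : {set {set 'I_n}}) : nat :=
  (n - 1 - #|E1 :&: E2|)%N.

Definition is_tree_code (n d : nat) (C : {set {set {set 'I_n}}}) : bool :=
  (C \subset spanning_trees n) &&
  [forall T1 in C, forall T2 in C, (T1 != T2) ==> (d <= tree_dist T1 T2)%N].

Definition A (n d : nat) : nat :=
  (\max_(C : {set {set {set 'I_n}}} | is_tree_code d C) #|C|)%N.

Definition Cdelta (R : realType) (delta : R) : R :=
  expR 1 / 2 * delta `^ (delta / (1 - delta)).

(* Main.v *)
Require Import Defs.
From HB Require Import structures.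
From mathcomp Require Import all_boot all_order all_algebra.
From mathcomp Require Import all_classical all_reals all_analysis.
From mathcomp Require Import zify ring lra.

Set Implicit Arguments.
Unset Strict Implicit.
Unset Printing Implicit Defensive.

Import Order.TTheory GRing.Theory Num.Theory.
Import numFieldNormedType.Exports.

Local Open Scope classical_set_scope.
Local Open Scope ring_scope.

(** Let th = n - d and N = 'C(n, 2).  Both bounds rest on two facts: the
    members of a tree code are connected, so they have at least n - 1 edges
    (connected_graph_edges), and distinct members share at most th - 1 edges.
    A code is thus a family of large subsets of an N-element set with small
    pairwise intersections.

    For d = delta n, every set of th edges lies in at most one member, and each
    member contains at least 'C(n - 1, th) of them.  Hence
    A(n, d) (n - 1)^_th <= N ^ th (tree_code_packing).  By Stirling's formula
    for the ratio n! / d! (stirling_ratio_ge), the resulting bound is (C_delta n) ^ th times at most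
    delta ^ (-1/2) exp (delta - 1) exp (1 / (4 d)).  The factor
    delta ^ (-1/2) exp (delta - 1) is at most 1.19 for delta >= 0.1313
    (ln_const_ge), and the last one tends to 1.  The properties of C_delta come
    from ln C_delta = 1 - ln 2 + delta ln delta / (1 - delta), where the last
    term is the opposite of the slope of the chord of the strictly convex
    function x ln x between delta and 1.  The number 0.1313 lies just above the
    solution of C_delta = 1 (Cdelta_threshold).

    For d = n - th with th = o(n), fix a set S of th - 2 edges.  The members
    containing S, once S is removed, pairwise share at most one edge and have
    at least w = d + 1 edges.  Counting the pairs of members through each edge
    bounds their number by N w / (w ^ 2 - N), which is about n, whereas packing
    would only give about n ^ 2 / 4.  Averaging over S gives
    (tree_code_second_moment)
      A(n, d) (n - 1)^_(th - 2) (w ^ 2 - N) <= N ^ (th - 1) w.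
    With t = th / n this is at most
    2 (n / 2) ^ (th - 1) (1 + 2 t) ^ (th - 2) (1 + 4 t) (small_theta_bound).
    The correction factor is 1 + O(th ^ 2 / n), which settles the cases
    th = o(sqrt n) and th constant.  If th >= c sqrt n, then th tends to
    infinity, and the leading 2 is absorbed in the (th - 1)-th power of a
    quantity 1 + o(1). *)

(** * Families of sets with small pairwise intersections *)

Lemma ffact_leX m k : (m ^_ k <= m ^ k)%N.
Proof.
have -> : (m ^ k = \prod_(i < k) m)%N by rewrite prod_nat_const card_ord.
rewrite ffact_prod; apply: leq_prod => i _; exact: leq_subr.
Qed.

Section Packing.
Local Open Scope set_scope.
Local Open Scope nat_scope.
Variable V : finType.
Implicit Types (U S T : {set V}) (C : {set {set V}}).

(** Count the pairs (S, T) with S a k-subset of T and T in C in both ways: a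
    member T contains at least 'C(w, k) sets S, and each S lies in at most B
    members. *)
Lemma subset_double_count U C w k B :
    (forall T, T \in C -> T \subset U /\ w <= #|T|) ->
    (forall S, #|S| = k -> #|[set T in C | S \subset T]| <= B) ->
  #|C| * 'C(w, k) <= 'C(#|U|, k) * B.
Proof.
move=> CU CB.
have drawsE (T : {set V}) :
    'C(#|T|, k) = \sum_(S : {set V} | (S \subset T) && (#|S| == k)) 1.
  rewrite -cards_draws -sum1_card; apply: eq_bigl => S.
  by rewrite inE.
apply: (@leq_trans (\sum_(T in C) 'C(#|T|, k))).
  by rewrite -sum_nat_const; apply: leq_sum => T /CU [_ wT]; exact: leq_bin2l.
under eq_bigr do rewrite drawsE.
rewrite (exchange_big_dep (fun S : {set V} => (S \subset U) && (#|S| == k))) /=.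
  rewrite (drawsE U) big_distrl /=; apply: leq_sum => S /andP[_ /eqP Sk].
  rewrite mul1n; apply: leq_trans (CB S Sk).
  rewrite -[leqRHS]sum1_card; apply: eq_leq.
  by apply: eq_bigl => T; rewrite inE Sk eqxx andbT.
by move=> T S /CU [TU _] /andP[ST ->]; rewrite (fintype.subset_trans ST TU).
Qed.

(** The Cauchy-Schwarz inequality, from 2 a b <= a ^ 2 + b ^ 2 summed over all
    pairs. *)
Lemma sum_sqr_leq (U : {set V}) (a : V -> nat) :
  (\sum_(e in U) a e) ^ 2 <= #|U| * \sum_(e in U) a e ^ 2.
Proof.
rewrite -(leq_pmul2l (isT : 0 < 2)) -mulnn big_distrlr /= big_distrr /=.
under eq_bigr do rewrite big_distrr /=.
have -> : 2 * (#|U| * \sum_(e in U) a e ^ 2) =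
   \sum_(e in U) \sum_(f in U) (a e ^ 2 + a f ^ 2).
  under [RHS]eq_bigr do rewrite big_split /= sum_nat_const.
  by rewrite big_split /= sum_nat_const -big_distrr /= mul2n addnn.
apply: leq_sum => e _; apply: leq_sum => f _; exact: nat_Cauchy.
Qed.

(** Let a(e) be the number of sets containing e.  The sum of a(e) is at least
    M w with M the number of sets, while the sum of a(e) ^ 2, which counts
    ordered pairs of sets together with a common element, exceeds the sum of a(e) by at
    most M ^ 2.  The bound follows by Cauchy-Schwarz. *)
Lemma second_moment_packing (I : finType) (J : {set I}) (D : I -> {set V}) U w :
    (forall i, i \in J -> D i \subset U /\ w <= #|D i|) ->
    (forall i j, i \in J -> j \in J -> i != j -> #|D i :&: D j| <= 1) ->
  #|J| * w ^ 2 <= #|U| * (w + #|J|).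
Proof.
move=> DU D1; set N := #|U|; set M := #|J|.
pose s := \sum_(i in J) #|D i|.
have sw : M * w <= s.
  by rewrite -sum_nat_const; apply: leq_sum => i /DU [].
pose a e := \sum_(i in J) (e \in D i).
have cardE (A : {set V}) : A \subset U -> \sum_(e in U) (e \in A) = #|A|.
  move=> AU; rewrite -sum1_card big_mkcond [RHS]big_mkcond /=.
  apply: eq_bigr => e _; case: ifPn => eU; first by case: (e \in A).
  by case: ifPn => // /(fintype.subsetP AU); rewrite (negbTE eU).
have sE : \sum_(e in U) a e = s.
  by rewrite exchange_big; apply: eq_bigr => i /DU [iU _]; exact: cardE.
have s2 : \sum_(e in U) a e ^ 2 <= s + M ^ 2.
  rewrite (eq_bigr (fun e => \sum_(i in J) \sum_(j in J) (e \in D i :&: D j)));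
    last first.
    move=> e _; rewrite -mulnn big_distrlr /=; apply: eq_bigr => i _.
    by apply: eq_bigr => j _; rewrite inE; case: (e \in D i); case: (e \in D j).
  rewrite exchange_big -mulnn -{1}/M -[M * M]sum_nat_const -big_split /=.
  apply: leq_sum => i iJ; rewrite exchange_big (bigD1 i) //= finset.setIid.
  have [iU _] := DU i iJ; rewrite cardE // leq_add2l -[M]sum1_card.
  rewrite [leqRHS](bigD1 i) //=; apply: leqW.
  apply: leq_sum => j /andP[jJ ji].
  rewrite cardE ?(fintype.subset_trans (finset.subsetIl _ _)) //.
  by apply: D1; rewrite // eq_sym.
have := sum_sqr_leq U a; rewrite sE => /leq_trans /(_ (leq_mul (leqnn _) s2)).
rewrite -/N => ss; rewrite leqNgt.
(* If the bound failed, then s >= M w > N, a range where s (s - N) increases. *)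
apply/negP => lt.
have M0 : 0 < M by move: lt; case: (M) => //; rewrite mul0n ltn0.
have MwN : N < M * w.
  have : N * w < M * w * w by rewrite -mulnA mulnn; lia.
  by rewrite ltn_mul2r => /andP[].
have ss' : s * (s - N) <= N * M ^ 2 by rewrite mulnBr; lia.
have h : (M * w) * (M * w - N) <= N * M ^ 2.
  by apply: leq_trans ss'; apply: leq_mul => //; exact: leq_sub2r.
have : w * (M * w - N) <= N * M.
  by rewrite -(leq_pmul2l M0) mulnA (leq_trans h) // -mulnn mulnCA leqnn.
by rewrite mulnBr; nia.
Qed.

(** No set of size k lies in two members of C, so the multiplicity B in the
    double count is 1. *)
Lemma set_packing_bound U C w k :
    (forall T, T \in C -> T \subset U /\ w <= #|T|) ->
    (forall T1 T2, T1 \in C -> T2 \in C -> T1 != T2 -> #|T1 :&: T2| < k) ->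
  #|C| * w ^_ k <= #|U| ^ k.
Proof.
move=> CU Ck.
have := @subset_double_count U C w k 1 CU; rewrite muln1 => dc.
rewrite -bin_ffact mulnA; apply: (@leq_trans ('C(#|U|, k) * k`!)).
  rewrite leq_mul2r dc ?orbT // => S Sk.
  apply/card_le1_eqP => T1 T2; rewrite !inE => /andP[C1 S1] /andP[C2 S2].
  apply/eqP/negPn/negP => T12.
  have := Ck _ _ C2 C1 T12; apply/negP; rewrite -leqNgt -{1}Sk.
  by apply: subset_leq_card; rewrite finset.subsetI S2 S1.
by rewrite bin_ffact ffact_leX.
Qed.

(** Remove a k-subset S from the members that contain it: what remains pairwise
    meets in at most one point, so the second moment bounds the number of these
    members by B = N w / (w ^ 2 - N), N being the size of U.  The double count
    then averages over S. *)
Lemma iterated_second_moment_packing U C w k :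
    (forall T, T \in C -> T \subset U /\ w + k <= #|T|) ->
    (forall T1 T2, T1 \in C -> T2 \in C -> T1 != T2 -> #|T1 :&: T2| <= k.+1) ->
    #|U| < w ^ 2 ->
  #|C| * ((w + k) ^_ k * (w ^ 2 - #|U|)) <= #|U| ^ k.+1 * w.
Proof.
move=> CU Ck Uw.
have := @subset_double_count U C (w + k) k (#|U| * w %/ (w ^ 2 - #|U|)) CU.
move=> dc; have /dc {dc} : forall S : {set V}, #|S| = k ->
    #|[set T in C | S \subset T]| <= #|U| * w %/ (w ^ 2 - #|U|).
  move=> S Sk; rewrite leq_divRL ?subn_gt0 //.
  have := @second_moment_packing _ [set T in C | S \subset T]
     (fun T => T :\: S) U w.
  rewrite mulnDr mulnBr [#|U| * #|_|]mulnC leq_subLR addnC; apply.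
    move=> T; rewrite inE => /andP[/CU[TU wT] ST].
    split; first exact: fintype.subset_trans (finset.subsetDl _ _) TU.
    by rewrite cardsDS // Sk leq_subRL ?(leq_trans (leq_addl _ _) wT) // addnC.
  move=> T1 T2; rewrite !inE => /andP[C1 S1] /andP[C2 S2] T12.
  rewrite -finset.setDIl cardsDS ?finset.subsetI ?S1 // Sk leq_subLR addn1.
  exact: Ck.
move=> le1.
rewrite -(leq_pmul2r (fact_gt0 k)) -mulnA bin_ffact mulnAC bin_ffact in le1.
rewrite mulnA; apply: leq_trans (leq_mul le1 (leqnn _)) _.
rewrite -mulnA [_ ^ k.+1]expnSr -mulnA; apply: leq_mul; first exact: ffact_leX.
exact: leq_divM.
Qed.
End Packing.

(** * Tree codes *)

(** Grow a vertex set S one vertex at a time, starting from a single vertex.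
    Connectedness gives an edge leaving S, which becomes a new edge inside the
    enlarged set. *)
Lemma connected_graph_edges n (E : {set {set 'I_n}}) :
  connected_graph E -> (n - 1 <= #|E|)%N.
Proof.
case: n E => [//|n] E Econn; rewrite subn1 /=.
suff grow k : (k <= n)%N -> exists S : {set 'I_n.+1},
    #|S| = k.+1 /\ (k <= #|[set e in E | e \subset S]%SET|)%N.
  have [S [_ nS]] := grow n (leqnn n); apply: leq_trans nS _.
  by apply/subset_leq_card/fintype.subsetP => e; rewrite inE => /andP[].
elim: k => [_|k IHk kn]; first by exists [set ord0]%SET; rewrite cards1.
have [S [Sk kE]] := IHk (ltnW kn).
have [x xS] : exists x, x \in S by apply/card_gt0P; rewrite Sk.
have [y yS] : exists y, y \notin S.
  have : (0 < #|(~: S)%SET|)%N.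
    by rewrite cardsCs finset.setCK Sk card_ord subSS subn_gt0.
  by case/card_gt0P => y; rewrite inE => yS; exists y.
(* Otherwise S would be a union of components and could not reach y. *)
have [u [v [uS vS uv]]] : exists u v, [/\ u \in S, v \notin S & adj E u v].
  apply: contrapT => no; have clS u v : adj E u v -> u \in S -> v \in S.
    by move=> uv uS; apply: contrapT => /negP vS; apply: no; exists u, v.
  have /connectP[p] := Econn x y.
  elim: p x xS => [|z p IHp] x xS /=; first by move=> _ yx; rewrite yx xS in yS.
  by case/andP => /clS /(_ xS) zS; exact: IHp.
exists (v |: S)%SET; split; first by rewrite cardsU1 vS Sk.
apply: leq_ltn_trans kE _; apply: proper_card; apply/properP; split.
  apply/fintype.subsetP => e; rewrite !inE => /andP[-> eS] /=.
  exact: fintype.subset_trans eS (finset.subsetUr _ _).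
exists [set u; v]%SET; rewrite inE.
  by rewrite -/(adj E u v) uv finset.subUset !finset.sub1set !inE uS eqxx orbT.
by rewrite finset.subUset !finset.sub1set (negPf vS) !andbF.
Qed.

(** The two properties through which tree codes enter the packing bounds. *)
Lemma tree_code_sets n d (C : {set {set {set 'I_n}}}) :
    (0 < d)%N -> is_tree_code d C ->
  (forall T, T \in C -> T \subset complete_edges n /\ (n - 1 <= #|T|)%N) /\
  (forall T1 T2, T1 \in C -> T2 \in C -> T1 != T2 ->
     (#|T1 :&: T2|%SET < n - d)%N).
Proof.
move=> d0 /andP[/fintype.subsetP Ctree /forall_inP Cd]; split.
  move=> T /Ctree; rewrite inE => /andP[TE /asboolP[Tconn _]].
  by split => //; exact: connected_graph_edges.
move=> T1 T2 C1 C2 T12.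
have /forall_inP/(_ T2 C2)/implyP/(_ T12) := Cd T1 C1.
by rewrite /tree_dist; lia.
Qed.

Lemma card_complete_edges n : #|complete_edges n| = 'C(n, 2).
Proof. by rewrite card_draws card_ord. Qed.

Lemma tree_code_packing n d :
  (0 < d)%N -> (A n d * (n - 1) ^_ (n - d) <= 'C(n, 2) ^ (n - d))%N.
Proof.
move=> d0; rewrite /A.
elim/big_ind: _ => [|a b ha hb|C codeC]; first by rewrite mul0n.
  by rewrite maxnMl geq_max ha.
have [CU Cd] := tree_code_sets d0 codeC.
by rewrite -card_complete_edges; exact: set_packing_bound.
Qed.

Lemma tree_code_second_moment n d k :
    (0 < d)%N -> (n = d + k.+2)%N -> ('C(n, 2) < d.+1 ^ 2)%N ->
  (A n d * ((n - 1) ^_ k * (d.+1 ^ 2 - 'C(n, 2))) <= 'C(n, 2) ^ k.+1 * d.+1)%N.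
Proof.
move=> d0 nE nd; rewrite /A.
elim/big_ind: _ => [|a b ha hb|C codeC]; first by rewrite mul0n.
  by rewrite maxnMl geq_max ha.
have [CU Cd] := tree_code_sets d0 codeC.
have dE : (n - 1 = d.+1 + k)%N by lia.
rewrite -card_complete_edges dE; apply: iterated_second_moment_packing.
- by move=> T /CU; rewrite dE.
- by move=> T1 T2 C1 C2 /(Cd _ _ C1 C2); lia.
- by rewrite card_complete_edges.
Qed.

(** * Logarithms and factorials *)

Section RealEstimates.
Context {R : realType}.
Implicit Types (x y t delta : R).

Lemma ger0_is_derive_le (f df : R -> R) (a b : R) : a <= b ->
    (forall x, a <= x <= b -> is_derive x 1 f (df x)) ->
    (forall x, a <= x <= b -> 0 <= df x) ->
  f a <= f b.
Proof.
move=> ab fdf df0.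
have fdf' x : x \in `]a, b[ -> is_derive x 1 f (df x).
  by rewrite in_itv /= => /andP[/ltW ax /ltW xb]; apply: fdf; rewrite ax.
have fc : {within `[a, b], continuous f}.
  apply: derivable_within_continuous => x; rewrite in_itv /= => xab.
  exact: (@ex_derive _ _ _ _ _ _ _ (fdf x xab)).
have [c + fE] := MVT_segment ab fdf' fc.
rewrite in_itv /= => cab; rewrite -subr_ge0 fE mulr_ge0 ?subr_ge0 //.
exact: df0.
Qed.

(** The derivative of the difference of the two sides is
    (1 - 1 / t) ^ 2 / 2.  In exponential form this is s <= sinh s, exact to
    second order at t = 1; both the telescoping error in Stirling's formula and
    the sharpness of the threshold 0.1313 rely on this precision. *)
Lemma ln_le_half_sub_inv t : 1 <= t -> ln t <= 2^-1 * (t - t^-1).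
Proof.
move=> t1; rewrite -subr_ge0.
have := @ger0_is_derive_le (fun t => 2^-1 * (t - t^-1) - ln t)
  (fun t => 2^-1 * (1 - t^-1) ^+ 2) 1 t t1.
rewrite /= ln1 invr1 subrr mulr0 subr0; apply.
- move=> x /andP[x1 _]; have x0 : x != 0 by rewrite gt_eqF //; lra.
  have dln : is_derive x 1 (@ln R) x^-1 by apply: is_derive1_ln; lra.
  have dinv : is_derive x 1 (fun t : R => t^-1) (- x ^- 2 *: 1).
    exact: (@is_deriveV _ id x).
  apply: (is_derive_eq (is_deriveB (is_deriveZ 2^-1
    (is_deriveB (is_derive_id x 1) dinv)) dln)).
  by rewrite /GRing.scale /=; field.
- by move=> x _; rewrite mulr_ge0 // sqr_ge0.
Qed.

(** The derivative of the right-hand side is 2 / (1 - x ^ 2), and that of the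
    left-hand side is a partial sum of its geometric series. *)
Lemma atanh_series_le x (m : nat) : 0 <= x < 1 ->
  2 * \sum_(k < m) x ^+ k.*2.+1 / k.*2.+1%:R <= ln (1 + x) - ln (1 - x).
Proof.
move=> /andP[x0 x1]; rewrite -subr_ge0.
pose p (k : 'I_m) (t : R) := k.*2.+1%:R^-1 * t ^+ k.*2.+1.
have pE t : 2 * (\sum_(k < m) t ^+ k.*2.+1 / k.*2.+1%:R) = 2 * (\sum_k p k) t.
  by rewrite fct_sumE; congr (_ * _); apply: eq_bigr => k _; rewrite /p mulrC.
have := @ger0_is_derive_le (fun t => ln (1 + t) - ln (1 - t) - 2 * (\sum_k p k) t)
  (fun t => (1 + t)^-1 + (1 - t)^-1 - 2 * \sum_(k < m) t ^+ k.*2) 0 x x0.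
have p0 : 2 * (\sum_k p k) 0 = 0.
  by rewrite -pE big1 ?mulr0 // => k _; rewrite expr0n mul0r.
rewrite pE /= p0 addr0 !subr0 ln1 subrr; apply.
- move=> t /andP[t0 tx].
  have dlnD : is_derive (1 + t) 1 (@ln R) (1 + t)^-1.
    by apply: is_derive1_ln; lra.
  have dlnB : is_derive (1 - t) 1 (@ln R) (1 - t)^-1.
    by apply: is_derive1_ln; lra.
  have dD : is_derive t 1 (fun u : R => 1 + u) (0 + 1) by apply: is_deriveD.
  have dB : is_derive t 1 (fun u : R => 1 - u) (0 - 1) by apply: is_deriveB.
  have dp k : is_derive t 1 (p k) (t ^+ k.*2).
    have -> : p k = k.*2.+1%:R^-1 *: ((@id R) ^+ k.*2.+1).
      by apply/funext => u; rewrite /p /= exprfctE.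
    apply: (is_derive_eq (is_deriveZ k.*2.+1%:R^-1
      (is_deriveX k.*2.+1 (is_derive_id t 1)))).
    by rewrite /GRing.scale /= mulr1 mulrA mulVf ?mul1r // pnatr_eq0.
  have := is_deriveB
    (is_deriveB (@is_derive1_comp _ (@ln R) (fun u => 1 + u) t _ _ dlnD dD)
      (@is_derive1_comp _ (@ln R) (fun u => 1 - u) t _ _ dlnB dB))
    (is_deriveZ 2 (is_derive_sum dp)).
  move/is_derive_eq; apply.
  by rewrite /GRing.scale /=; ring.
- move=> t /andP[t0 tx].
  have geo : (1 - t ^+ 2) * (\sum_(k < m) t ^+ k.*2) = 1 - t ^+ m.*2.
    under eq_bigr do rewrite -mul2n exprM.
    by rewrite -mul2n exprM -[1 - t ^+ 2]opprB mulNr -subrX1 opprB.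
  have -> : (1 + t)^-1 + (1 - t)^-1 = 2 / (1 - t ^+ 2).
    by field; rewrite !gt_eqF //; nra.
  have t2 : 0 < 1 - t ^+ 2 by nra.
  rewrite subr_ge0 ler_pdivlMr // -mulrA [_ * (1 - _)]mulrC geo.
  by rewrite ler_piMr // gerBl exprn_ge0.
Qed.

(** The fraction is within 3e-6 of ln 2, which is the accuracy needed in
    Cdelta_threshold. *)
Lemma ln2_gt : 637 / 919 <= ln (2 : R).
Proof.
have third : 0 <= (3^-1 : R) < 1 by lra.
have := @atanh_series_le 3^-1 5 third.
have -> : ln (1 + 3^-1) - ln (1 - 3^-1) = ln (2 : R).
  by rewrite -ln_div ?posrE; [congr ln; field | lra | lra].
by rewrite !big_ord_recl big_ord0 /= /bump /= !(addn0, add1n, doubleS, double0); lra.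
Qed.

Lemma expR_taylor_le (x : R) m : 0 <= x -> \sum_(k < m) x ^+ k / k`!%:R <= expR x.
Proof.
move=> x0; rewrite -(big_mkord xpredT (fun k => x ^+ k / k`!%:R)).
apply: (@nondecreasing_cvgn_le _ (series (exp_coeff x))).
  apply/nondecreasing_seqP => k; rewrite /series /= big_nat_recr //= lerDl.
  by rewrite /exp_coeff /= divr_ge0 // exprn_ge0.
exact: is_cvg_series_exp_coeff.
Qed.

(** One step of Stirling's formula.  With t = (k + 1) / k, the product of
    k + 1 / 2 and (t - 1 / t) / 2 is exactly 1 + (1 / k - 1 / (k + 1)) / 4, whose
    error term telescopes. *)
Lemma ln_succ_le (k : nat) : (0 < k)%N ->
  (k%:R + 2^-1) * (ln k.+1%:R - ln k%:R) <= 1 + 4^-1 * (k%:R^-1 - k.+1%:R^-1) :> R.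
Proof.
move=> k0; have k0R : 0 < k%:R :> R by rewrite ltr0n.
have -> : k.+1%:R = k%:R + 1 :> R by rewrite natr1.
move: (k%:R : R) k0R => x x0.
have x10 : 0 < x + 1 by lra.
have x1 : 1 <= (x + 1) / x by rewrite ler_pdivlMr //; lra.
rewrite -ln_div ?posrE //.
have := ln_le_half_sub_inv x1; rewrite invf_div => le1.
have := ler_wpM2l (_ : 0 <= x + 2^-1) le1 => /(_ _).
have -> : (x + 2^-1) * (2^-1 * ((x + 1) / x - x / (x + 1))) =
  1 + 4^-1 * (x^-1 - (x + 1)^-1).
  by field; rewrite !gt_eqF.
by apply; lra.
Qed.

(** Stirling's formula for the ratio n! / d!, where its constant cancels, with
    an error of at most 1 / (4 d). *)
Lemma stirling_ratio_ge (d n : nat) : (0 < d <= n)%N ->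
  (n%:R + 2^-1) * ln n%:R - (d%:R + 2^-1) * ln d%:R - (n%:R - d%:R)
    - 4^-1 * (d%:R^-1 - n%:R^-1)
  <= ln n`!%:R - ln d`!%:R :> R.
Proof.
move=> /andP[d0 dn].
elim: n dn => [|n IHn]; first by rewrite leqn0 => /eqP d0'; rewrite d0' in d0.
rewrite leq_eqVlt => /predU1P[->|]; first by rewrite !subrr mulr0 subr0.
rewrite ltnS => dn; have n0 : (0 < n)%N by apply: leq_trans dn.
rewrite factS natrM lnM ?posrE ?ltr0n ?fact_gt0 //.
have := IHn dn; have := ln_succ_le n0; rewrite -[n.+1%:R]natr1.
lra.
Qed.

Lemma ln_lt_sub1 x : 0 < x -> x != 1 -> ln x < x - 1.
Proof.
move=> x0 x1; have lnx : ln x != 0 by rewrite ln_eq0.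
by have := expR_gt1Dx lnx; rewrite lnK ?posrE //; lra.
Qed.

Lemma ln_le_sub1 x : 0 < x -> ln x <= x - 1.
Proof.
by move=> x0; have := @le_ln1Dx _ (x - 1); rewrite addrCA subrr addr0; apply; lra.
Qed.

(** * The constant C_delta *)

Lemma CdeltaE delta : 0 < delta ->
  Cdelta delta = expR (1 - ln 2 + delta / (1 - delta) * ln delta).
Proof.
move=> d0; rewrite /Cdelta /powR gt_eqF // -[in LHS](@lnK _ (2 : R)) ?posrE //.
by rewrite -expRB -expRD.
Qed.

(** Up to sign these are the slopes of the chords of x ln x from b to 1 and from
    a to 1, so this is strict convexity.  It is proved with the tangent at b. *)
Lemma xlnx_div_decr (a b : R) : 0 < a -> a < b -> b < 1 ->
  b / (1 - b) * ln b < a / (1 - a) * ln a.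
Proof.
move=> a0 ab b1.
have b0 : 0 < b by lra.
have lnab : ln b - ln a < b / a - 1.
  rewrite -ln_div ?posrE //; apply: ln_lt_sub1; first by rewrite divr_gt0.
  by rewrite gt_eqF // ltr_pdivlMr // mul1r.
have lnb : ln b <= b - 1 by exact: ln_le_sub1.
have a_ne : a != 0 by rewrite gt_eqF.
have lnab' : a * ln b - a * ln a < b - a.
  have -> : b - a = a * (b / a - 1) by field.
  by rewrite -mulrBr ltr_pM2l.
rewrite ![_ / _ * ln _]mulrAC ltr_pdivrMr ?subr_gt0 //.
rewrite [ltRHS]mulrAC ltr_pdivlMr; last by lra.
have h1 : 0 <= (b - a) * (b - 1 - ln b) by apply: mulr_ge0; lra.
have h2 : 0 < (1 - b) * (b - a - (a * ln b - a * ln a)) by apply: mulr_gt0; lra.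
lra.
Qed.

Lemma Cdelta_lt (a b : R) : 0 < a -> a < b -> b < 1 -> Cdelta b < Cdelta a.
Proof.
move=> a0 ab b1; rewrite !CdeltaE //; last by lra.
by rewrite ltr_expR ltrD2l; exact: xlnx_div_decr.
Qed.

(** Both come from ln x <= x - 1: at delta it gives
    delta ln delta / (1 - delta) <= - delta, and at 1 / delta it gives
    delta ln delta / (1 - delta) > -1. *)
Lemma Cdelta_bounds delta : 0 < delta < 1 ->
  1 / 2 < Cdelta delta /\ Cdelta delta <= expR (1 - delta) / 2.
Proof.
move=> /andP[d0 d1]; rewrite CdeltaE //.
have lnd : ln delta <= delta - 1 by exact: ln_le_sub1.
have lnd' : ln delta^-1 < delta^-1 - 1.
  by apply: ln_lt_sub1; [rewrite invr_gt0|rewrite invr_eq1 lt_eqF].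
have d_ne : delta != 0 by rewrite gt_eqF.
have d1_ne : 1 - delta != 0 by rewrite gt_eqF // subr_gt0.
have r0 : 0 < delta / (1 - delta) by rewrite divr_gt0 // subr_gt0.
rewrite -[X in _ < _ /\ _ <= _ / X](@lnK _ (2 : R)) ?posrE // -expRB ler_expR.
have -> : 1 / 2 = expR (- ln 2) :> R by rewrite expRN lnK ?posrE // div1r.
rewrite ltr_expR; split.
  rewrite lnV ?posrE // in lnd'; rewrite -(ltr_pM2l r0) in lnd'.
  have e : delta / (1 - delta) * (delta^-1 - 1) = 1 by field; apply/andP.
  by rewrite e in lnd'; lra.
rewrite -(ler_pM2l r0) in lnd.
have e : delta / (1 - delta) * (delta - 1) = - delta by field.
by rewrite e in lnd; lra.
Qed.

(** The logarithm of C_delta is here about -1.3e-5, so ln 2 and ln delta are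
    needed with an absolute accuracy of order 1e-5.  Since 8 * 0.1313 = 1.0504
    is close to 1, ln delta = ln 1.0504 - 3 ln 2 reduces the estimate to ln 2 and
    to a logarithm near 0. *)
Lemma Cdelta_threshold delta : 10000 * delta = 1313 -> Cdelta delta < 1.
Proof.
move=> dE.
have ln_eighth (u : R) : 0 < u -> ln (u / 8) = ln u - 3 * ln 2.
  move=> u0; rewrite mulr_natl -lnXn // -[2 ^+ 3]natrX.
  by rewrite ln_div ?posrE.
have t1 : 1 <= 8 * delta by lra.
(* Rounded up from 0.049191, while ln 1.0504 is about 0.049171. *)
have lnt : ln (8 * delta) <= 492 / 10000.
  apply: le_trans (ln_le_half_sub_inv t1) _.
  have : 952 / 1000 <= (8 * delta)^-1 by rewrite -[leRHS]div1r ler_pdivlMr; lra.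
  lra.
have ratioE : delta / (1 - delta) = 1313 / 8687.
  have d1 : 1 - delta != 0 by rewrite gt_eqF //; lra.
  have := divfK d1 delta; move: (delta / (1 - delta)) => r.
  have {1}-> : delta = 1313 / 10000 by lra.
  lra.
have lnd : ln delta = ln (8 * delta) - 3 * ln 2.
  by rewrite -ln_eighth; [congr ln; lra | lra].
rewrite CdeltaE; last by lra.
rewrite expR_lt1 ratioE lnd.
move: (ln (8 * delta)) (ln 2) lnt ln2_gt => s l; lra.
Qed.

Lemma Cdelta_in delta : 1313 / 10000 < delta < 1 -> 1 / 2 < Cdelta delta < 1.
Proof.
move=> /andP[d0 d1]; have dpos : 0 < delta by lra.
have [lo _] := @Cdelta_bounds delta ltac:(by rewrite dpos d1).
rewrite lo.
apply: lt_trans (Cdelta_threshold (delta := 1313 / 10000) _); last by lra.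
apply: Cdelta_lt; [lra | exact: d0 | exact: d1].
Qed.

Lemma Cdelta_cvg : Cdelta delta @[delta --> (1 : R)^'-] --> (1 / 2 : R).
Proof.
apply: (@squeeze_cvgr _ _ _ _ (fun=> 1 / 2) (fun delta => expR (1 - delta) / 2)).
- near=> delta.
  have [] := @Cdelta_bounds delta.
    by apply/andP; split; near: delta; [exact: nbhs_left_gt | exact: nbhs_left_lt].
  by move=> /ltW -> ->.
- exact: cvg_cst.
- have -> : 1 / 2 = expR (1 - 1) / 2 :> R by rewrite subrr expR0.
  apply: cvgM; last exact: cvg_cst.
  apply: continuous_cvg; first exact: continuous_expR.
  apply: cvgB; first exact: cvg_cst.
  exact: cvg_at_left_filter.
Unshelve. all: by end_near. Qed.

End RealEstimates.

(** * Distance proportional to n *)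

Lemma ffact_pred_fact (n d : nat) : (0 < d <= n)%N ->
  ((n - 1) ^_ (n - d) * n * d`! = d * n`!)%N.
Proof.
case: n d => [|n] [|d] //= dn; rewrite subSS subn0.
rewrite !factS -(ffact_fact (leq_subr d n)) subKn //; ring.
Qed.

Lemma bin2_mul2 n : ('C(n, 2) * 2 = n * (n - 1))%N.
Proof. by have := bin_ffact n 2; rewrite ffactnS ffactn1 -subn1. Qed.

Section TreeCodeBounds.
Context {R : realType}.

Lemma ln_ffact_pred (n d : nat) : (0 < d <= n)%N ->
  ln ((n - 1) ^_ (n - d))%:R = ln d%:R + ln n`!%:R - ln n%:R - ln d`!%:R :> R.
Proof.
move=> dn; have /andP[d0 dn'] := dn.
have n0 : (0 < n)%N by exact: leq_trans dn'.
have P0 : (0 < (n - 1) ^_ (n - d))%N.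
  by rewrite ffact_gt0 leq_sub2l.
have := congr1 (fun k : nat => ln (k%:R : R)) (ffact_pred_fact dn).
rewrite !natrM !lnM ?posrE ?mulr_gt0 ?ltr0n ?fact_gt0 //.
by lra.
Qed.

Lemma ln_bin2 (n : nat) : (1 < n)%N ->
  ln 'C(n, 2)%:R = ln n%:R + ln (n%:R - 1) - ln 2 :> R.
Proof.
move=> n1; have n0 : (0 < n)%N by exact: ltnW.
have := congr1 (fun k : nat => ln (k%:R : R)) (bin2_mul2 n).
rewrite !natrM natrB // !lnM ?posrE ?ltr0n ?bin_gt0 // ?subr_gt0 ?ltr1n //.
by lra.
Qed.

(** Equivalently 1.19 ^ 2 delta exp (2 (1 - delta)) >= 1.  With y = 1 - delta and
    P the Taylor polynomial of degree 4 of exp (2 y), the product (1 - y) P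
    equals 1 + y - (2 / 3) (y ^ 3 + y ^ 4 + y ^ 5), which stays above 0.71 for
    0 <= y <= 0.869. *)
Lemma ln_const_ge (delta : R) : 1313 / 10000 <= delta <= 1 ->
  0 <= 2 * ln (119 / 100) + ln delta + 2 * (1 - delta).
Proof.
move=> /andP[d0 d1]; have dpos : 0 < delta by lra.
have [y yE] : exists y, delta = 1 - y by exists (1 - delta); lra.
have y0 : 0 <= 2 * y by lra.
have y1 : y <= 869 / 1000 by lra.
clear d0 d1.
have -> : 2 * (1 - delta) = ln (expR (2 * y)) by rewrite expRK; lra.
have := expR_taylor_le 5 y0.
move: (expR_gt0 (2 * y)).
move: (expR (2 * y)) => e e0.
rewrite !big_ord_recl big_ord0 /= /bump /= !(addn0, add1n) => tay.
have [c [c0 cE]] : exists c : R, 0 < c /\ c = 119 / 100.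
  by exists (119 / 100); split; lra.
rewrite -cE.
have -> : 2 * ln c + ln delta + ln e = ln (c ^+ 2 * delta * e).
  by rewrite !lnM ?posrE ?mulr_gt0 ?exprn_gt0 //; ring.
apply: ln_ge0.
have c2 : 141 / 100 <= c ^+ 2 by rewrite cE; lra.
have {}tay : 1 + 2 * y + 2 * y ^+ 2 + 4 / 3 * y ^+ 3 + 2 / 3 * y ^+ 4 <= e.
  by move: tay; rewrite !factS fact0; lra.
have delta_e : (1 - y) * (1 + 2 * y + 2 * y ^+ 2 + 4 / 3 * y ^+ 3 + 2 / 3 * y ^+ 4)
    <= delta * e.
  by rewrite yE ler_wpM2l //; lra.
have y0' : 0 <= y by lra.
have ypow k : y ^+ k.+2 <= 869 / 1000 * y ^+ k.+1.
  by rewrite exprS ler_wpM2r // exprn_ge0.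
have : 71 / 100 <= delta * e.
  by have := ypow 0; have := ypow 1; have := ypow 2; have := ypow 3; lra.
nra.
Qed.

(** The two sides are compared through their logarithms.  Writing x = n, their
    difference is, by Stirling's formula, at least
    ln 1.2 + (ln delta) / 2 + (n - d) (ln x - ln (x - 1)) - 1 / (4 d); the third
    term is at least 1 - delta, and 1 / (4 d) <= ln 1.2 - ln 1.19 once d >= 30. *)
Lemma large_distance_bound (delta : R) (n d : nat) :
    1313 / 10000 < delta < 1 -> (1 < d <= n - 2)%N -> d%:R = delta * n%:R ->
    (30 <= d)%N ->
  (A n d)%:R <= 12 / 10 * (Cdelta delta * n%:R) ^+ (n - d).
Proof.
move=> del /andP[d1 dn] dE d30.
have const := @ln_const_ge delta ltac:(by case/andP: del => a b; rewrite !ltW).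
have {del}/andP[del0 del1] : 0 < delta < 1.
  by apply/andP; split; case/andP: del; lra.
have n3 : (3 < n)%N by lia.
pose m := (n - d)%N; rewrite -/m.
pose x : R := n%:R; pose P : R := ((n - 1) ^_ m)%:R.
have x3 : 3 < x by rewrite ltr_nat.
have P0 : 0 < P by rewrite ltr0n ffact_gt0 /m; lia.
have mE : m%:R = x - delta * x by rewrite natrB -?dE //; lia.
have dpos : 0 < d%:R :> R by rewrite ltr0n; lia.
have C0 : 0 < 'C(n, 2)%:R :> R by rewrite ltr0n bin_gt0; lia.
have code : (A n d)%:R * P <= 'C(n, 2)%:R ^+ m.
  by rewrite -natrM -natrX ler_nat tree_code_packing //; lia.
suff : 'C(n, 2)%:R ^+ m <= 12 / 10 * (Cdelta delta * n%:R) ^+ m * P.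
  by move=> /(le_trans code); rewrite ler_pM2r.
have Cd0 : 0 < Cdelta delta by rewrite CdeltaE // expR_gt0.
have b0 : 0 < Cdelta delta * n%:R by rewrite mulr_gt0 // -/x; lra.
have c12 : 0 < 12 / 10 :> R by lra.
rewrite -ler_ln ?posrE ?mulr_gt0 ?exprn_gt0 //.
have lnP : ln P = ln d%:R + ln n`!%:R - ln n%:R - ln d`!%:R.
  by apply: ln_ffact_pred; rewrite (ltnW d1) (leq_trans dn (leq_subr _ _)).
have lnC : ln 'C(n, 2)%:R = ln x + ln (x - 1) - ln 2 :> R.
  by apply: ln_bin2; apply: leq_trans n3.
have lnd : ln d%:R = ln delta + ln x by rewrite dE lnM ?posrE // -/x; lra.
have step : x^-1 <= ln x - ln (x - 1).
  have : ln ((x - 1) / x) <= (x - 1) / x - 1.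
    by apply: ln_le_sub1; rewrite divr_gt0; lra.
  rewrite ln_div ?posrE; [|lra|lra].
  have -> : (x - 1) / x - 1 = - x^-1 by field; rewrite gt_eqF; lra.
  lra.
have mstep : 1 - delta <= (x - delta * x) * (ln x - ln (x - 1)).
  have -> : 1 - delta = (x - delta * x) * x^-1 by field; rewrite gt_eqF; lra.
  by rewrite ler_wpM2l // -mE ler0n.
have slack : ln (119 / 100) + 4^-1 * (d%:R)^-1 <= ln (12 / 10) :> R.
  have : ln (119 / 120) <= 119 / 120 - 1 :> R by apply: ln_le_sub1; lra.
  have -> : 119 / 120 = 119 / 100 / (12 / 10) :> R by lra.
  rewrite ln_div ?posrE; [|lra|lra].
  have : (d%:R)^-1 <= 30^-1 :> R by rewrite lef_pV2 ?posrE ?ler_nat //; lra.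
  lra.
have mr : (x - delta * x) * (delta / (1 - delta) * ln delta) = delta * x * ln delta.
  by field; rewrite gt_eqF; lra.
have xV : 0 <= x^-1 by rewrite invr_ge0; lra.
have d_n : (0 < d <= n)%N by rewrite (ltnW d1) (leq_trans dn (leq_subr _ _)).
have := @stirling_ratio_ge R d n d_n.
rewrite lnM ?posrE ?mulr_gt0 ?exprn_gt0 // lnM ?posrE ?exprn_gt0 //.
rewrite !lnXn // -![ln _ *+ m]mulr_natl mE lnC lnP lnM ?posrE //; last first.
  by rewrite -/x; lra.
rewrite CdeltaE // expRK -/x lnd dE.
rewrite dE in slack.
move: mr; move: (delta / (1 - delta)) => r mr.
move: mr mstep step slack const xV.
move: (ln x) (ln (x - 1)) (ln delta) (ln 2) (ln n`!%:R) (ln d`!%:R)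
  (ln (12 / 10)) (ln (119 / 100)) x^-1 (delta * x)^-1.
move=> L L1 l l2 Fn Fd k12 k119 xv dv.
lra.
Qed.
End TreeCodeBounds.

(** * Distance close to n *)

Lemma ffact_geX (m k b : nat) : (b + k <= m.+1)%N -> (b ^ k <= m ^_ k)%N.
Proof.
move=> bkm; have -> : (b ^ k = \prod_(i < k) b)%N by rewrite prod_nat_const card_ord.
by rewrite ffact_prod; apply: leq_prod => i _; have := ltn_ord i; lia.
Qed.

Section SmallTheta.
Context {R : realType}.
Implicit Types (x y t : R).

Lemma exprD1_ge y m : 0 <= y -> 1 + m%:R * y <= (1 + y) ^+ m.
Proof.
move=> y0; elim: m => [|m IHm]; first by rewrite mul0r addr0 expr0.
rewrite exprS -natr1; apply: le_trans (ler_wpM2l _ IHm); last by lra.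
have m0 : 0 <= m%:R * y ^+ 2 by rewrite mulr_ge0 // exprn_ge0.
lra.
Qed.

Lemma exprD1_le y m : 0 <= y -> m%:R * y <= 2^-1 ->
  (1 + y) ^+ m <= 1 + 2 * (m%:R * y).
Proof.
move=> y0; elim: m => [|m IHm]; first by rewrite mul0r mulr0 addr0 expr0.
rewrite exprS -natr1 => my.
have m0 : 0 <= m%:R :> R by [].
apply: le_trans (ler_wpM2l _ (IHm _)) _; [lra | lra |].
have : 0 <= y * (1 - 2 * (m%:R * y)) by rewrite mulr_ge0 //; lra.
lra.
Qed.

(** Here t = th / n and d = (1 - t) n.  The falling factorial is at least d ^ k,
    and N / d <= (n / 2) (1 + 2 t).  The remaining quotient N w / (w ^ 2 - N)
    decreases in w >= (1 - t) n and is at most n (1 + 4 t) because t <= 1 / 14. *)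
Lemma small_theta_bound (n d k : nat) (t : R) :
    n = (d + k.+2)%N -> k.+2%:R = t * n%:R -> t <= 14^-1 ->
  (A n d)%:R <= 2 * (n%:R / 2) ^+ k.+1 * ((1 + 2 * t) ^+ k * (1 + 4 * t)).
Proof.
move=> nE tE t14.
pose x : R := n%:R; rewrite -/x in tE *.
have x2 : 2 <= x by rewrite ler_nat nE; lia.
have t0 : 0 <= t.
  have : 0 <= t * x by rewrite -tE.
  by rewrite pmulr_lge0 //; lra.
have dE : d%:R = x - t * x by rewrite -tE /x nE natrD; lra.
have d0 : 0 < d%:R :> R by rewrite dE; nra.
pose N : R := 'C(n, 2)%:R; pose w : R := d.+1%:R.
have wE : w = x - t * x + 1 by rewrite /w -natr1 dE.
have NE : N * 2 = x * (x - 1).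
  rewrite /N /x -natrM bin2_mul2 natrM natrB //; lia.
have N0 : 0 <= N by rewrite /N.
have NW : N < w ^+ 2 by rewrite wE; nra.
have codeN : ('C(n, 2) < d.+1 ^ 2)%N by rewrite -(ltr_nat R) natrX.
have d0' : (0 < d)%N by rewrite -(ltr_nat R).
have := tree_code_second_moment d0' nE codeN.
have P_ge := @ffact_geX (n - 1) k d ltac:(lia).
rewrite -(ler_nat R) !natrM natrB ?(ltnW codeN) // !natrX -/N -/w.
move/(le_trans _) => code.
have {code} code : (A n d)%:R * (d%:R ^+ k * (w ^+ 2 - N)) <= N ^+ k.+1 * w.
  apply: code; rewrite ler_wpM2l // ler_wpM2r //; first by lra.
  by rewrite -natrX ler_nat.
have NkD : N ^+ k <= (x / 2 * (1 + 2 * t) * d%:R) ^+ k.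
  by apply: lerXn2r; rewrite ?nnegrE ?mulr_ge0 //; rewrite ?dE; nra.
have Nw : N * w <= x * (1 + 4 * t) * (w ^+ 2 - N).
  have xt : t * x <= 14^-1 * x by rewrite ler_wpM2r //; lra.
  have tx0 : 0 <= t * x by rewrite mulr_ge0 //; lra.
  (* The polynomial (1 + 4 t) v ^ 2 - (x / 2) (v + x (1 + 4 t)) is nonnegative
     at v = (1 - t) x, by base, and does not decrease from there to w, by incr. *)
  have base : 0 <= x ^+ 2 * (t * (1 - 14 * t) + 8 * t ^+ 3).
    by rewrite mulr_ge0 ?exprn_ge0 ?addr_ge0 ?mulr_ge0 ?exprn_ge0 //; lra.
  have incr : 0 <= (w - (x - t * x)) * ((1 + 4 * t) * (w + (x - t * x)) - x / 2).
    have : 0 <= t * (w + (x - t * x)) by rewrite mulr_ge0 //; lra.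
    by move=> h; rewrite mulr_ge0 //; lra.
  have quad : x / 2 * (w + x * (1 + 4 * t)) <= (1 + 4 * t) * w ^+ 2.
    by move: base incr; move: (w) => v; lra.
  have : N * (w + x * (1 + 4 * t)) <= x * (x / 2 * (w + x * (1 + 4 * t))).
    rewrite mulrA ler_wpM2r //; last by lra.
    by rewrite addr_ge0 ?mulr_ge0 //; lra.
  have := ler_wpM2l (_ : 0 <= x) quad => /(_ ltac:(lra)).
  by move: (w) => v; lra.
have Q0 : 0 < d%:R ^+ k * (w ^+ 2 - N) by rewrite mulr_gt0 ?exprn_gt0 // subr_gt0.
rewrite -(ler_pM2r Q0); apply: le_trans code _.
rewrite exprSr -mulrA; apply: le_trans (ler_pM _ _ NkD Nw) _.
- by rewrite exprn_ge0.
- by rewrite mulr_ge0.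
rewrite 2!exprMn [_ ^+ k.+1]exprSr.
move: (w ^+ 2 - N) ((x / 2) ^+ k) ((1 + 2 * t) ^+ k) (d%:R ^+ k) => D u v z.
lra.
Qed.

Lemma small_theta_excess (k : nat) (t : R) : 0 <= t -> k.+1%:R * (4 * t) <= 2^-1 ->
  (1 + 2 * t) ^+ k * (1 + 4 * t) <= 1 + 2 * (k.+1%:R * (4 * t)).
Proof.
move=> t0 kt; apply: le_trans (exprD1_le _ kt); last by lra.
rewrite exprSr ler_wpM2r //; first by lra.
by apply: lerXn2r; rewrite ?nnegrE; lra.
Qed.

(** With t = th / n and th = k + 2, the correction factor differs from 1 by
    O(th ^ 2 / n). *)
Lemma small_theta_excess_sqr (n k : nat) : (0 < n)%N ->
    8 * k.+2%:R ^+ 2 <= n%:R :> R ->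
  (1 + 2 * (k.+2%:R / n%:R)) ^+ k * (1 + 4 * (k.+2%:R / n%:R)) <=
  1 + 8 * k.+2%:R ^+ 2 / n%:R :> R.
Proof.
move=> n0 kn; have n0R : 0 < n%:R :> R by rewrite ltr0n.
have t0 : 0 <= k.+2%:R / n%:R :> R by rewrite divr_ge0.
have kt : k.+1%:R * (4 * (k.+2%:R / n%:R)) <= 4 * k.+2%:R ^+ 2 / n%:R :> R.
  have : k.+1%:R * (k.+2%:R / n%:R) <= k.+2%:R * (k.+2%:R / n%:R) :> R.
    by rewrite ler_wpM2r // ler_nat.
  lra.
have sqr_n : 8 * k.+2%:R ^+ 2 / n%:R <= 1 :> R by rewrite ler_pdivrMr // mul1r.
by apply: le_trans (small_theta_excess t0 _) _; lra.
Qed.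

(** The constant 2 (1 + 4 t) <= 3 (1 + 2 t) is absorbed by
    (1 + 2 / (k + 1)) ^ (k + 1) >= 3. *)
Lemma small_theta_power_bound (k : nat) (x t : R) : 0 <= x -> 0 <= t -> t <= 14^-1 ->
  2 * (x / 2) ^+ k.+1 * ((1 + 2 * t) ^+ k * (1 + 4 * t)) <=
  ((1 / 2 + 2^-1 * ((1 + 2 * t) * (1 + 2 / k.+1%:R) - 1)) * x) ^+ k.+1.
Proof.
move=> x0 t0 t14.
have -> : (1 / 2 + 2^-1 * ((1 + 2 * t) * (1 + 2 / k.+1%:R) - 1)) * x =
   x / 2 * ((1 + 2 * t) * (1 + 2 / k.+1%:R)) by move: (2 / k.+1%:R) => q; field.
have k0 : (k.+1%:R : R) != 0 by rewrite pnatr_eq0.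
have three : 3 <= (1 + 2 / k.+1%:R : R) ^+ k.+1.
  apply: le_trans (exprD1_ge _ _); last by rewrite divr_ge0.
  by rewrite [_ * (2 / _)]mulrC divfK //; lra.
rewrite [leRHS]exprMn [((1 + 2 * t) * _) ^+ _]exprMn [(1 + 2 * t) ^+ k.+1]exprSr.
rewrite [2 * _]mulrC -mulrA ler_wpM2l ?exprn_ge0 ?divr_ge0 //.
have v0 : 0 <= (1 + 2 * t) ^+ k by rewrite exprn_ge0 //; lra.
rewrite mulrCA -[leRHS]mulrA ler_wpM2l //.
apply: (@le_trans _ _ ((1 + 2 * t) * 3)); first by lra.
by rewrite ler_wpM2l //; lra.
Qed.

(** The lower bound th >= c sqrt n forces th to infinity, so that 2 / (th - 1)
    tends to 0. *)
Lemma small_eps_littleo (theta : nat -> nat) :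
    (fun n : nat => (theta n)%:R : R) =o_\oo (fun n : nat => n%:R : R) ->
    (fun n : nat => (theta n)%:R : R) =Omega_\oo
        (fun n : nat => Num.sqrt n%:R : R) ->
  (fun n => 2^-1 * ((1 + 2 * ((theta n)%:R / n%:R)) *
     (1 + 2 / (theta n).-1%:R) - 1) : R) =o_\oo (fun _ : nat => 1 : R).
Proof.
move=> /eqoP theta_o; rewrite eqOmegaE qualifE => /asboolP[c c0 theta_Om].
apply/eqoP => e e0.
have e'0 : 0 < Num.min 1 e / 4 by rewrite divr_gt0 // lt_min ltr01 e0.
have theta_e := theta_o _ e'0.
near=> n.
have n1 : 1 <= n%:R :> R by near: n; exact: nbhs_infty_ger.
have : `|(theta n)%:R| <= Num.min 1 e / 4 * `|n%:R| :> R by near: n.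
have : c * `|Num.sqrt n%:R| <= `|(theta n)%:R| :> R by near: n.
have : ((1 + 8 / e) / c) ^+ 2 <= n%:R by near: n; exact: nbhs_infty_ger.
rewrite !normr_nat ger0_norm ?sqrtr_ge0 //.
set th : R := (theta n)%:R => n_large th_ge th_le.
have e8 : 0 < 8 / e by rewrite divr_gt0.
have th_large : 1 + 8 / e <= th.
  apply: le_trans th_ge; rewrite [leRHS]mulrC -ler_pdivrMr //.
  have y0 : 0 <= (1 + 8 / e) / c by rewrite divr_ge0 //; lra.
  by rewrite -(ger0_norm y0) -sqrtr_sqr ler_sqrt //; lra.
have thE : th = 1 + (theta n).-1%:R.
  have theta0 : (0 < theta n)%N by rewrite -(ltr_nat R) -/th; lra.
  by rewrite /th -{1}(prednK theta0) -natr1 addrC.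
set q : R := (theta n).-1%:R in thE *.
have q0 : 0 < q by lra.
have qe : 2 / q <= e / 4.
  rewrite ler_pdivrMr //.
  have : e / 4 * (8 / e) <= e / 4 * q by rewrite ler_wpM2l //; lra.
  have -> : e / 4 * (8 / e) = 2 by field; rewrite gt_eqF.
  by [].
have tau0 : 0 <= th / n%:R by rewrite divr_ge0 //; lra.
have tau_min : th / n%:R <= Num.min 1 e / 4 by rewrite ler_pdivrMr //; lra.
have min1 : Num.min 1 e <= 1 by rewrite ge_min lexx.
have mine : Num.min 1 e <= e by rewrite ge_min lexx orbT.
have p0 : 0 <= 2 / q by rewrite divr_ge0 // ltW.
move: (th / n%:R) (2 / q) tau0 tau_min p0 qe => tau p tau0 tau_min p0 qe.
have tp : tau * p <= 4^-1 * p by rewrite ler_wpM2r //; lra.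
have tp0 : 0 <= tau * p by rewrite mulr_ge0.
rewrite normr1 mulr1 ger0_norm; lra.
Unshelve. all: by end_near. Qed.

(** Writing th = k + 2 makes the truncated subtractions in the exponents exact,
    and t <= 1 / 14 holds eventually because th = o(n). *)
Lemma small_theta_eventually (d theta : nat -> nat) :
    (\forall n \near \oo,
      [/\ (1 < d n <= n - 2)%N, d n = (n - theta n)%N & (2 <= theta n)%N]) ->
    (fun n : nat => (theta n)%:R : R) =o_\oo (fun n : nat => n%:R : R) ->
  \forall n \near \oo, exists k,
    [/\ theta n = k.+2, (n - d n - 1 = k.+1)%N, (n - d n - 2 = k)%N, (0 < n)%N &
      (theta n)%:R / n%:R <= 14^-1 :> R /\
      (A n (d n))%:R <= 2 * (n%:R / 2) ^+ k.+1 *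
        ((1 + 2 * ((theta n)%:R / n%:R)) ^+ k *
         (1 + 4 * ((theta n)%:R / n%:R))) :> R].
Proof.
move=> dtheta /eqoP theta_o.
have theta14 := theta_o 14^-1 ltac:(by rewrite invr_gt0).
near=> n.
have [dn dE theta2] : [/\ (1 < d n <= n - 2)%N, d n = (n - theta n)%N
   & (2 <= theta n)%N] by near: n.
have : `|(theta n)%:R| <= 14^-1 * `|n%:R| :> R by near: n.
rewrite !normr_nat => theta_le.
have n0 : (0 < n)%N by lia.
have n0R : 0 < n%:R :> R by rewrite ltr0n.
have t14 : (theta n)%:R / n%:R <= 14^-1 :> R by rewrite ler_pdivrMr.
exists (theta n).-2; split => //; [lia | lia | lia | split => //].
apply: small_theta_bound => //; first by lia.
by rewrite divfK ?gt_eqF //; congr (_%:R); lia.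
Unshelve. all: by end_near. Qed.

End SmallTheta.

(** * The theorem *)

Theorem mainTheorem2 (R : realType) :
  ((forall delta : R, 1313 / 10000 < delta < 1 ->
      (\forall n \near \oo, forall d : nat,
         (1 < d <= n - 2)%N -> d%:R = delta * n%:R ->
         (A n d)%:R <= 12 / 10 * (Cdelta delta * n%:R) ^+ (n - d))
      /\ 1 / 2 < Cdelta delta < 1)
   /\ (forall delta1 delta2 : R,
         1313 / 10000 < delta1 < 1 -> 1313 / 10000 < delta2 < 1 ->
         delta1 < delta2 -> Cdelta delta2 < Cdelta delta1)
   /\ (Cdelta delta @[delta --> (1 : R)^'-] --> (1 / 2 : R)))
  /\
  (forall d theta : nat -> nat,
     (\forall n \near \oo,
        [/\ (1 < d n <= n - 2)%N, d n = (n - theta n)%N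
          & (2 <= theta n)%N]) ->
     (fun n : nat => (theta n)%:R : R) =o_\oo (fun n : nat => n%:R : R) ->
     ((fun n : nat => (theta n)%:R : R) =Omega_\oo
        (fun n : nat => Num.sqrt n%:R : R) ->
      exists eps : nat -> R,
        eps =o_\oo (fun _ : nat => 1 : R) /\
        \forall n \near \oo,
          (A n (d n))%:R <= ((1 / 2 + eps n) * n%:R) ^+ (n - d n - 1))
     /\
     ((fun n : nat => (theta n)%:R : R) =o_\oo
        (fun n : nat => Num.sqrt n%:R : R) ->
      \forall n \near \oo,
        (A n (d n))%:R <= 21 / 10 * (n%:R / 2 : R) ^+ (n - d n - 1))
     /\
     ((exists t : nat, forall n : nat, theta n = t) ->
      exists r : nat -> R,
        r =O_\oo (fun n : nat => n%:R ^+ (n - d n - 2) : R) /\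
        \forall n \near \oo,
          (A n (d n))%:R <= 2 * (n%:R / 2) ^+ (n - d n - 1) + r n)).
Proof.
split.
  split; last split.
  - move=> delta del; split; last exact: Cdelta_in.
    have d0 : 0 < delta by case/andP: del; lra.
    near=> n => d dn dE; apply: large_distance_bound => //.
    rewrite -(ler_nat R) dE mulrC -ler_pdivrMr //.
    by near: n; exact: nbhs_infty_ger.
  - move=> a b /andP[a0 a1] /andP[b0 b1] ab.
    by apply: Cdelta_lt; [lra | exact: ab | exact: b1].
  - exact: Cdelta_cvg.
move=> d theta dtheta theta_o.
have bound := @small_theta_eventually R d theta dtheta theta_o.
split; [|split].
- move=> theta_Om.
  (* The choice of eps making small_theta_power_bound the claimed bound. *)
  exists (fun n => 2^-1 * ((1 + 2 * ((theta n)%:R / n%:R)) *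
     (1 + 2 / (theta n).-1%:R) - 1)).
  split; first exact: small_eps_littleo.
  apply: filterS bound => n [k [thE -> _ n0 [t14 An]]].
  apply: le_trans An _; rewrite {4}thE /=.
  by apply: small_theta_power_bound => //; rewrite divr_ge0.
- move=> /eqoP theta_sqrt.
  have theta20 := theta_sqrt 20^-1 ltac:(by rewrite invr_gt0).
  apply: filterS2 bound theta20 => n [k [thE -> _ n0 [_ An]]].
  have n0R : 0 < n%:R :> R by rewrite ltr0n.
  rewrite thE normr_nat ger0_norm ?sqrtr_ge0 // => theta_le.
  (* With th ^ 2 <= n / 400 the bound is 2 (1 + 8 / 400) = 2.04 times the power. *)
  have sqr_le : k.+2%:R ^+ 2 <= 400^-1 * n%:R :> R.
    have -> : 400^-1 * n%:R = (20^-1 * Num.sqrt n%:R) ^+ 2 :> R.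
      by rewrite exprMn sqr_sqrtr //; field.
    by apply: lerXn2r; rewrite ?nnegrE ?mulr_ge0 ?sqrtr_ge0.
  apply: le_trans An _; rewrite thE [leRHS]mulrC.
  have p0 : 0 <= (n%:R / 2 : R) ^+ k.+1 by rewrite exprn_ge0 // divr_ge0.
  rewrite [2 * _]mulrC -mulrA ler_wpM2l //.
  have exc := @small_theta_excess_sqr R n k n0 ltac:(lra).
  have : 8 * k.+2%:R ^+ 2 / n%:R <= 50^-1 :> R by rewrite ler_pdivrMr //; lra.
  lra.
- move=> [t thetaE].
  (* This dominates 2 (n / 2) ^ (t - 1) * 8 t ^ 2 / n. *)
  exists (fun n => 16 * t%:R ^+ 2 * n%:R ^+ (n - d n - 2)); split.
    apply/eqO_exP; exists (16 * t%:R ^+ 2 + 1).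
      by rewrite ltr_wpDl // mulr_ge0 // exprn_ge0.
    near=> n; rewrite normrM ger0_norm; last by rewrite mulr_ge0 // exprn_ge0.
    by rewrite ler_wpM2r // lerDl.
  have big := @nbhs_infty_ger R (8 * t%:R ^+ 2).
  apply: filterS2 bound big => n [k [thE -> -> n0 [t14 An]]] n_large.
  have n0R : 0 < n%:R :> R by rewrite ltr0n.
  apply: le_trans An _; rewrite -(thetaE n) thE in n_large *.
  have exc := small_theta_excess_sqr n0 n_large.
  have p0 : 0 <= 2 * (n%:R / 2 : R) ^+ k.+1.
    by rewrite mulr_ge0 // exprn_ge0 // divr_ge0.
  apply: le_trans (ler_wpM2l p0 exc) _.
  rewrite mulrDr mulr1 lerD2l.
  have half : (2^-1 : R) ^+ k.+1 <= 1 by rewrite exprn_ile1 //; lra.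
  have -> : 2 * (n%:R / 2) ^+ k.+1 * (8 * k.+2%:R ^+ 2 / n%:R) =
    16 * k.+2%:R ^+ 2 * n%:R ^+ k * 2^-1 ^+ k.+1 :> R.
    by rewrite exprMn [n%:R ^+ k.+1]exprSr; field; rewrite gt_eqF.
  by rewrite ler_piMr // !mulr_ge0 // exprn_ge0.
Unshelve. all: by end_near. Qed.
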